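(* Let $X$ be an infinite Hausdorff topological space and let $\mathcal{B}$ be a bornology on $X$. Let $\Phi=\Omega$ or $\Phi=\Gamma$, and put $\tilde\Phi^{\uparrow}_{\mathcal B}=\mathcal{D}^{\uparrow}_{\mathcal B}$ if $\Phi=\Omega$ and $\tilde\Phi^{\uparrow}_{\mathcal B}=\mathcal{S}^{\uparrow}_{\mathcal B}$ if $\Phi=\Gamma$. Assume that the set $C^*(X)$ of bounded continuous real functions is countably dense in $\langle USC^*(X),\tau_{\mathcal B}\rangle$. Let $\mathbf 0$ be the constant zero function on $X$. Then the following are equivalent: (a) $\langle USC^*(X),\tau_{\mathcal B}\rangle$ satisfies the selection principle $\mathrm{S}_1(\tilde\Phi^{\uparrow}_{\mathcal B},\mathcal{D})$. (b) $\langle USC^*(X),\tau_{\mathcal B}\rangle$ is separable and $X$ possesses the covering property $\mathrm{S}_1(\Phi_{\mathcal B},\Omega_{\mathcal B})$. (c) $\langle USC^*(X),\tau_{\mathcal B}\rangle$ is separable and satisfies the selection principle $\mathrm{S}_1(\Phi_{\mathbf 0,\mathcal B},\Omega_{\mathbf 0,\mathcal B})$. (d) $\langle USC^*(X),\tau_{\mathcal B}\rangle$ is separable and satisfies the selection principle $\mathrm{S}_1(\tilde\Phi^{\uparrow}_{\mathcal B},\Omega_{\mathbf 0,\mathcal B})$.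
   Context: A bornology $\mathcal{B}$ on $X$ is a proper ideal of subsets of $X$ with $\bigcup\mathcal{B}=X$. Covers. A family $\mathcal U$ of subsets of $X$ is a cover if $\bigcup\mathcal U=X$; it is open if all its members are open. $\Omega_{\mathcal B}=\Omega_{\mathcal B}(X)$ is the family of all open $\mathcal B$-$\omega$-covers, i.e. open covers $\mathcal U$ with $X\notin\mathcal U$ such that for every $B\in\mathcal B$ there is $U\in\mathcal U$ with $B\subseteq U$. $\Gamma_{\mathcal B}=\Gamma_{\mathcal B}(X)$ is the family of all open $\mathcal B$-$\gamma$-covers, i.e. infinite open covers $\mathcal U$ such that for every $B\in\mathcal B$ the set $\{U\in\mathcal U: B\not\subseteq U\}$ is finite (by convention $X\notin\mathcal U$ may be assumed). Functions. A function $f:X\to\mathbb R$ is upper semicontinuous if $\{x\in X: f(x)<a\}$ is open for every real $a$. $H=USC^*(X)$ is the set of all bounded upper semicontinuous real functions on $X$. The topology $\tau_{\mathcal B}$ has as basic neighborhoods of $h$ the sets $\{f:(\forall x\in B)\,|h(x)-f(x)|<\varepsilon\}$, $B\in\mathcal B$, $\varepsilon>0$. All density and convergence in $H$ is with respect to $\tau_{\mathcal B}$. A set $F\subseteq H$ is countably dense in $H$ if for every $f\in H$ there is a countable $G\subseteq F$ with $f\in\overline G$. For $h\in H$: $\Omega_{h,\mathcal B}$ is the family of all $F\subseteq H$ such that $h\notin F$, $h\in\overline F$ (closure in $\tau_{\mathcal B}$), and every $f\in F$ satisfies $f\ge h$ and $f-h\in H$. $\Gamma_{h,\mathcal B}$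 is the family of all infinite $F\subseteq H$ such that for every $\varepsilon>0$ and every $B\in\mathcal B$ the set $\{f\in F:(\exists x\in B)\,|f(x)-h(x)|\ge\varepsilon\}$ is finite, and every $f\in F$ satisfies $f\ge h$ and $f-h\in H$. $\mathcal D$ is the family of all dense subsets of $H$. A set $F\subseteq H$ is upper dense in $H$ if for every $f\in H$ the set $\{h\in F: h\ge f\text{ and }h-f\in H\}$ is dense in the set $\{h\in H:h\ge f\}$. $F\subseteq H$ is upper sequentially dense in $H$ if for every $f\in H$ there is a sequence $\langle h_n:n\in\omega\rangle$ of elements of $F$ such that $h_n\to f$, and $h_n\ge f$ and $h_n-f\in H$ for each $n$. $\mathcal D^{\uparrow}_{\mathcal B}$ (resp. $\mathcal S^{\uparrow}_{\mathcal B}$) is the family of all upper dense (resp. upper sequentially dense) subsets of $\langle H,\tau_{\mathcal B}\rangle$. Selection principle. $\mathrm S_1(\mathcal A,\mathcal C)$: for every sequence $\langle A_n:n\in\omega\rangle$ of elements of $\mathcal A$ there are $a_n\in A_n$ ($n\in\omega$) such that $\{a_n:n\in\omega\}\in\mathcal C$. *)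

(* Defs.v *)
From HB Require Import structures.
From mathcomp Require Import all_boot all_order all_algebra.
From mathcomp Require Import all_classical all_reals all_analysis.
Set Implicit Arguments.
Unset Strict Implicit.
Unset Printing Implicit Defensive.
Import Order.TTheory GRing.Theory Num.Theory.
Import numFieldNormedType.Exports.
Local Open Scope classical_set_scope.
Local Open Scope ring_scope.

Definition S1 (T : Type) (A C : set (set T)) : Prop :=
  forall F : nat -> set T, (forall n, A (F n)) ->
    exists a : nat -> T, (forall n, F n (a n)) /\ C (range a).

Record bornology (X : Type) (B : set (set X)) : Prop := Bornology {
  bornology0 : B set0;
  bornology_sub : forall A A' : set X, A `<=` A' -> B A' -> B A;
  bornologyU : forall A A' : set X, B A -> B A' -> B (A `|` A');
  bornology_proper : ~ B [set: X];
  bornology_cover : \bigcup_(A in B) A = [set: X] }.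

Section covers.
Context (X : topologicalType).
Implicit Types (B UU : set (set X)).

Definition open_cover UU : Prop :=
  (forall U, UU U -> open U) /\ \bigcup_(U in UU) U = [set: X].

Definition Omega_cover B : set (set (set X)) :=
  [set UU | [/\ open_cover UU, ~ UU [set: X] &
    forall A, B A -> exists2 U, UU U & A `<=` U]].

(* Following the usual convention, [set: X] is excluded from gamma-covers too;
   deleting it from an infinite gamma-cover leaves a gamma-cover. *)
Definition Gamma_cover B : set (set (set X)) :=
  [set UU | [/\ open_cover UU, ~ UU [set: X], infinite_set UU &
    forall A, B A -> finite_set [set U | UU U /\ ~ (A `<=` U)]]].

End covers.

Section functions.
Context (R : realType) (X : topologicalType).
Implicit Types (B : set (set X)) (f g h : X -> R) (F G : set (X -> R)).

Definition upper_semicontinuous f : Prop :=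
  forall a : R, open [set x | f x < a].

Definition USCb : set (X -> R) :=
  [set f | upper_semicontinuous f /\ bounded_fun f].

Definition Cb : set (X -> R) := [set f | continuous f /\ bounded_fun f].

(* tau_B is the topology induced on USCb by uniform convergence on the members
   of B, i.e. by {family B, X -> R}; its neighborhood base is computed in
   nbhs_tauP below. Closures are taken in {family B, X -> R}: intersected with
   USCb, they are the closures in USCb. *)
Definition cl B F : set (X -> R) := closure (F : set {family B, X -> R}).

Definition dense_in B F G : Prop := F `<=` G /\ G `<=` cl B F.

Definition countably_dense B F : Prop :=
  F `<=` USCb /\
  forall f, USCb f -> exists G, [/\ countable G, G `<=` F & cl B G f].

Definition separable_USCb B : Prop :=
  exists F, countable F /\ dense_in B F USCb.

Definition usc_above h f : Prop := (forall x, h x <= f x) /\ USCb (f \- h).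

Definition Omega_at h B : set (set (X -> R)) :=
  [set F | [/\ F `<=` USCb, ~ F h, cl B F h &
    forall f, F f -> usc_above h f]].

Definition Gamma_at h B : set (set (X -> R)) :=
  [set F | [/\ F `<=` USCb, infinite_set F,
    forall (e : R) (A : set X), 0 < e -> B A ->
      finite_set [set f | F f /\ exists2 x, A x & e <= `|f x - h x|] &
    forall f, F f -> usc_above h f]].

Definition Dense B : set (set (X -> R)) := [set F | dense_in B F USCb].

Definition upper_dense B : set (set (X -> R)) :=
  [set F | F `<=` USCb /\
    forall f, USCb f ->
      dense_in B [set h | F h /\ usc_above f h]
                 [set h | USCb h /\ forall x, f x <= h x]].

Definition upper_seq_dense B : set (set (X -> R)) :=
  [set F | F `<=` USCb /\
    forall f, USCb f ->
      exists h : nat -> X -> R,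
        [/\ forall n, F (h n), {family B, h @ \oo --> f} &
            forall n, usc_above f (h n)]].

End functions.

Arguments Dense R {X} B.
Arguments upper_dense R {X} B.
Arguments upper_seq_dense R {X} B.
Arguments separable_USCb R {X} B.

Variant cover_kind := Omega | Gamma.

Definition Phi_cover (Phi : cover_kind) (X : topologicalType)
    (B : set (set X)) : set (set (set X)) :=
  match Phi with Omega => Omega_cover B | Gamma => Gamma_cover B end.

Definition Phi_at (Phi : cover_kind) (R : realType) (X : topologicalType)
    (h : X -> R) (B : set (set X)) : set (set (X -> R)) :=
  match Phi with Omega => Omega_at h B | Gamma => Gamma_at h B end.

Definition Phi_up (Phi : cover_kind) (R : realType) (X : topologicalType)
    (B : set (set X)) : set (set (X -> R)) :=
  match Phi with Omega => upper_dense R B | Gamma => upper_seq_dense R B end.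

Arguments Phi_up Phi R {X} B.

Lemma nbhs_tauP (R : realType) (X : topologicalType) (B : set (set X))
    (h : X -> R) (W : set (X -> R)) : bornology B ->
  nbhs (h : {family B, X -> R}) W <->
  exists (A : set X) (e : R), [/\ B A, 0 < e &
    [set f : X -> R | forall x, A x -> `|h x - f x| < e] `<=` W].
Proof.
move=> bB; split; last first.
  move=> [A [e [BA e0 AW]]]; apply: filterS AW _.
  have := @fam_nbhs X R B A [set xy | ball xy.1 e xy.2] h.
  by apply => //; apply: (@entourage_ball R R (PosNum e0)).
pose base (AE : set X * R) :=
  [set f : X -> R | forall x, AE.1 x -> `|h x - f x| < AE.2].
pose FF : set_system (X -> R) :=
  filter_from [set AE : set X * R | B AE.1 /\ 0 < AE.2] base.
have FFF : Filter FF.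
  apply: filter_from_filter.
    by exists (set0, 1) => /=; split=> //; apply: bornology0 bB.
  move=> [A e] [A' e'] /= [BA e0] [BA' e'0].
  exists (A `|` A', Num.min e e').
    by split => /=; [exact: (bornologyU bB)|rewrite lt_min e0].
  by move=> f /= fP; split => x /= Ax; have := fP x;
    rewrite lt_min => /(_ ltac:(by [left|right])) /andP[].
have : {family B, FF --> h}.
  apply/fam_cvgP => A BA U; rewrite /= uniform_nbhs => -[E [entE EU]].
  move: entE; rewrite -entourage_ballE => -[e /= e0 eE].
  exists (A, e) => //= f fP; apply: EU => x Ax; apply: eE => /=.
  exact: fP.
move=> + nW => /(_ W nW) [[A e] /= [BA e0] AW].
by exists A, e.
Qed.

(* Main.v *)
Require Import Defs.
From mathcomp Require Import all_boot all_order all_algebra.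
From mathcomp Require Import all_classical all_reals all_analysis.
From mathcomp Require Import lra.
Import Order.TTheory GRing.Theory Num.Theory.
Import numFieldNormedType.Exports.
Local Open Scope classical_set_scope.
Local Open Scope ring_scope.

(* (a) => (b): if every member of a family UU is open and UU covers the
   members of B, the functions that are >= 1 off some U in UU form an upper
   dense set; a selection from such sets having 0 in its closure yields a
   selection of the U's covering each member of B.
   (b) => (c): pass from f to the open set {f < 1/(n+1)} at stage n; if this set
   is all of X for infinitely many n, a selection converging uniformly to 0
   is available directly.
   (c) => (d): select around the constant 1/(n+1) at stage n.
   (d) => (a): upper density is invariant under translation by d in USC*, so a
   selection accumulating at 0 gives one accumulating at d; do this for each d
   in a countable dense set, splitting the index set into infinitely many
   pieces. *)

(** * Infinite sets, and selections along a tail of the index set *)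

Lemma infinite_image (T U : Type) (f : T -> U) (A : set T) :
  infinite_set A -> (forall y, finite_set [set x | A x /\ f x = y]) ->
  infinite_set (f @` A).
Proof.
move=> infA fin_fib finfA; apply: infA.
apply: (@sub_finite_set _ _ (\bigcup_(y in f @` A) [set x | A x /\ f x = y])).
  by move=> x Ax; exists (f x) => //; exists x.
exact: bigcup_finite.
Qed.

(** An injection of [nat] into [A] meets a finite [S] at finitely many indices only; past their
    maximum it avoids [S]. *)
Lemma infinite_set_seq (T : Type) (A : set T) : infinite_set A ->
  exists u : nat -> T, (forall n, A (u n)) /\
    forall S, finite_set S -> \forall n \near \oo, ~ S (u n).
Proof.
move=> /infiniteP/card_leP[f].
pose u n := val (f (SigSub (mem_set I : n \in [set: nat]))).
exists u; split; first by move=> n; apply: set_valP.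
move=> S finS.
have inju : injective u.
  move=> m n /= mn.
  have := @inj _ _ _ f _ _ (in_setT _) (in_setT _) (val_inj mn).
  by move=> /(congr1 val).
have : finite_set (u @^-1` S) by apply: finite_preimage => // m n _ _ /inju.
move=> /finite_seqP[s sE].
exists (\max_(i <- s) i).+1 => //= n /= maxn Sn.
have : n \in s by have : [set` s] n by rewrite -sE.
by move=> /(@leq_bigmax_seq _ s xpredT id) => /(_ erefl); rewrite leqNgt maxn.
Qed.

(** The principle is applied to the shifted sequence [F (N + n)] and the choice is reindexed by
    [n - N]. This serves when the [F n] are known to lie in [A] only from some stage on. *)
Lemma S1_tail (T : Type) (A C : set (set T)) (F : nat -> set T) (N : nat) : S1 A C ->
  (forall n, (N <= n)%N -> A (F n)) ->
  exists a : nat -> T, (forall n, (N <= n)%N -> F n (a n)) /\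
    C (a @` [set n | (N <= n)%N]).
Proof.
move=> selAC AF.
have [n|a [Fa Ca]] := selAC (fun n => F (N + n)%N).
  by apply: AF; rewrite leq_addr.
exists (fun n => a (n - N)%N); split.
  by move=> n Nn; have := Fa (n - N)%N; rewrite subnKC.
suff -> : [set a (n - N)%N | n in [set n | (N <= n)%N]] = range a by [].
apply/seteqP; split => [_ [n _ <-]|_ [n _ <-]]; first by exists (n - N)%N.
by exists (N + n)%N => /=; [rewrite leq_addr|rewrite addKn].
Qed.

Lemma infinitely_often_or_eventually_not (P : nat -> Prop) :
  (forall N, exists2 n, (N <= n)%N & P n) \/
  exists N, forall n, (N <= n)%N -> ~ P n.
Proof.
have [|/existsNP[N NP]] := pselect (forall N, exists2 n, (N <= n)%N & P n).
  by left.
by right; exists N => n Nn Pn; apply: NP; exists n.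
Qed.

(** * Bounded upper semicontinuous functions and the relation [usc_above] *)

Section usc.
Context {R : realType} {X : topologicalType}.
Implicit Types (f g h : X -> R).

Lemma bounded_funP f : bounded_fun f <-> exists M, forall x, `|f x| <= M.
Proof.
split => [[M [_ fM]]|[M fM]].
  by exists (M + 1) => x; apply: fM => //; rewrite ltrDl.
exists M; split; first exact: num_real.
by move=> N MN x _; rewrite /= (le_trans (fM x))// ltW.
Qed.

Lemma uscD f g : upper_semicontinuous f -> upper_semicontinuous g ->
  upper_semicontinuous (f \+ g).
Proof.
move=> uf ug a; rewrite openE => x /= fga.
(* Half of the gap, so that the bounds [f x + d] and [g x + d] add up to [a]. *)
pose d := (a - f x - g x) / 2.
have : open_nbhs x ([set y | f y < f x + d] `&` [set y | g y < g x + d]).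
  by split; [exact: openI|split; rewrite /d /=; lra].
by move/open_nbhs_nbhs; apply: filterS => y; rewrite /d /= => -[]; lra.
Qed.

Lemma USCb_cst (c : R) : USCb (fun _ : X => c).
Proof.
split; last by apply/bounded_funP; exists `|c|.
move=> a; have [ca|ca] := boolP (c < a).
  by rewrite (_ : [set _ | _] = setT) ?predeqE//; exact: openT.
by rewrite (_ : [set _ | _] = set0) ?predeqE//; exact: open0.
Qed.

Lemma USCbD f g : USCb f -> USCb g -> USCb (f \+ g).
Proof.
move=> [uf /bounded_funP[M fM]] [ug /bounded_funP[N gN]]; split.
  exact: uscD.
apply/bounded_funP; exists (M + N) => x.
by rewrite (le_trans (ler_normD _ _))// lerD.
Qed.

Lemma USCb_max f c : USCb f -> USCb (fun x => Num.max (f x) c).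
Proof.
move=> [uf /bounded_funP[M fM]]; split; last first.
  apply/bounded_funP; exists (M + `|c|) => x.
  by have := fM x; case: (leP (f x) c) => _ ?; have := normr_ge0 (f x);
     have := normr_ge0 c; lra.
move=> a; have [ca|ca] := boolP (c < a).
  rewrite (_ : [set _ | _] = [set x | f x < a]); first exact: uf.
  by apply/seteqP; split => x /=; rewrite gt_max ca andbT.
rewrite (_ : [set _ | _] = set0); first exact: open0.
by apply/seteqP; split => x //=; rewrite gt_max (negbTE ca) andbF.
Qed.

(** The function is 0 on [U] and [c] off [U]: a nonnegative multiple of the indicator of a closed
    set. *)
Lemma USCb_patch0 (U : set X) (c : R) : 0 <= c -> open U ->
  USCb (patch (fun=> c) U (fun=> 0)).
Proof.
move=> c0 oU; split; last first.
  apply/bounded_funP; exists c => x.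
  by rewrite /patch; case: ifP => _; rewrite ?normr0// ger0_norm.
move=> a; have [ac|ca] := leP a c.
  have [a0|a0] := leP a 0.
    rewrite (_ : [set _ | _] = set0); first exact: open0.
    by apply/seteqP; split => x //=; rewrite /patch; case: ifP => _; lra.
  rewrite (_ : [set _ | _] = U) //; apply/seteqP; split => x /=.
    by rewrite /patch; case: ifPn => [/set_mem//|_]; lra.
  by move=> Ux; rewrite /patch mem_set.
rewrite (_ : [set _ | _] = setT); first exact: openT.
by apply/seteqP; split => x //= _; rewrite /patch; case: ifP => _; lra.
Qed.

Lemma CbB f g : Cb f -> Cb g -> Cb (f \- g).
Proof.
move=> [cf /bounded_funP[M fM]] [cg /bounded_funP[N gN]]; split.
  by move=> x; apply: cvgB; [exact: cf|exact: cg].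
apply/bounded_funP; exists (M + N) => x.
by rewrite (le_trans (ler_normB _ _))// lerD.
Qed.

Lemma usc_above_addr f u : USCb u -> (forall x, 0 <= u x) ->
  usc_above f (f \+ u).
Proof.
move=> Hu u0; split => [x|]; first by rewrite /= lerDl.
by rewrite (_ : (f \+ u) \- f = u)//; apply/funext => x /=; rewrite addrC addKr.
Qed.

Lemma usc_above_trans f g h : usc_above f g -> usc_above g h -> usc_above f h.
Proof.
move=> [fg Ugf] [gh Uhg]; split => [x|]; first exact: le_trans (gh x).
rewrite (_ : h \- f = (h \- g) \+ (g \- f)); first exact: USCbD.
by apply/funext => x /=; rewrite addrA subrK.
Qed.

Lemma usc_above_addl f g h : usc_above f g -> usc_above (f \+ h) (g \+ h).
Proof.
move=> [fg U]; split => [x|]; first by rewrite /= lerD2r.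
rewrite (_ : _ \- _ = g \- f)//.
by apply/funext => x /=; rewrite opprD addrACA subrr addr0.
Qed.

End usc.

(** * Closure and convergence for uniform convergence on the members of [B] *)

Section bornological.
Context {R : realType} {X : topologicalType} {B : set (set X)}.
Hypothesis bornB : bornology B.
Implicit Types (f g h u : X -> R) (F G : set (X -> R)) (A : set X).

Let zero : X -> R := fun=> 0.

Lemma bornology_set1 x : B [set x].
Proof.
have := bornology_cover bornB => /seteqP[_ /(_ x I)] [A BA Ax].
by apply: bornology_sub BA => // y ->.
Qed.

Lemma bornologyU1 A x : B A -> B (A `|` [set x]).
Proof. by move=> BA; apply: bornologyU => //; exact: bornology_set1. Qed.

Lemma bornology_nonempty : exists x : X, True.
Proof.
apply: contrapT => X0; apply: (bornology_proper bornB).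
rewrite (_ : [set: X] = set0); first exact: bornology0.
by apply/seteqP; split => // x _; apply: X0; exists x.
Qed.

Lemma clP F h : cl B F h <-> forall A e, B A -> 0 < e ->
  exists2 f, F f & forall x, A x -> `|h x - f x| < e.
Proof.
split=> [clFh A e BA e0|clFh W /((nbhs_tauP _ _ bornB).1)[A [e [BA e0 AW]]]].
  have [|f [Ff fA]] := clFh [set f : X -> R | forall x, A x -> `|h x - f x| < e].
    by apply: (nbhs_tauP _ _ bornB).2; exists A, e; split.
  by exists f.
by have [f Ff fA] := clFh A e BA e0; exists f; split => //; exact: AW.
Qed.

Lemma cvg_famP (h : nat -> X -> R) f : {family B, h @ \oo --> f} <->
  forall A e, B A -> 0 < e ->
    \forall n \near \oo, forall x, A x -> `|f x - h n x| < e.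
Proof.
split=> [hf A e BA e0|hf W].
  apply: (hf [set g : X -> R | forall x, A x -> `|f x - g x| < e]).
  by apply: (nbhs_tauP _ _ bornB).2; exists A, e; split.
move=> /((nbhs_tauP _ _ bornB).1)[A [e [BA e0 AW]]].
by apply: filterS (hf A e BA e0) => n; apply: AW.
Qed.

(** Indices are discarded one at a time. To discard [N], a point [x] where [a N] differs from [h] is
    added to the test set and [e] is lowered to at most [|h x - a N x|], which rules out [a N]. *)
Lemma cl_tail (a : nat -> X -> R) h (S : set nat) N : (forall n, S n -> a n <> h) ->
  cl B (a @` S) h -> cl B (a @` [set n | S n /\ (N <= n)%N]) h.
Proof.
move=> ah clah; elim: N => [|N IHN].
  by apply: closure_subset clah => _ [n Sn <-]; exists n.
apply/clP => A e BA e0.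
have [/ah aNh|SN] := pselect (S N); last first.
  have [_ [n [Sn Nn] <-] nA] := (clP _ _).1 IHN A e BA e0.
  exists (a n) => //; exists n => //; split=> //; rewrite ltn_neqAle Nn andbT.
  by apply/eqP => Nn'; rewrite Nn' in SN.
have [x aNx] : exists x, a N x != h x.
  apply: contrapT => H; apply: aNh; apply/funext => x.
  by apply: contrapT => /eqP ?; apply: H; exists x.
have d0 : 0 < `|h x - a N x| by rewrite normr_gt0 subr_eq0 eq_sym.
have e'0 : 0 < Num.min e `|h x - a N x| by rewrite lt_min e0.
have [_ [n [Sn Nn] <-] nA] := (clP _ _).1 IHN _ _ (bornologyU1 _ x BA) e'0.
exists (a n) => [|y Ay]; last first.
  by have := nA y (or_introl Ay); rewrite lt_min => /andP[].
exists n => //; split=> //; rewrite ltn_neqAle Nn andbT.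
apply/eqP => nN; have := nA x (or_intror erefl).
by rewrite -nN lt_min ltxx andbF.
Qed.

(** As for closures: since [U N] is not the whole space, adding to [A] a point outside [U N] forces
    the covering set to have another index. *)
Lemma Omega_cover_tail (U : nat -> set X) (S : set nat) N A :
  Omega_cover B (U @` S) -> B A -> exists2 n, S n /\ (N <= n)%N & A `<=` U n.
Proof.
move=> [_ UT covU]; elim: N A => [|N IHN] A BA.
  by have [_ [n Sn <-] AU] := covU _ BA; exists n.
have [SN|SN] := pselect (S N); last first.
  have [n [Sn Nn] AU] := IHN A BA; exists n => //; split => //.
  rewrite ltn_neqAle Nn andbT; by apply/eqP => Nn'; rewrite Nn' in SN.
have [x UNx] : exists x, ~ U N x.
  apply: contrapT => H; apply: UT; exists N => //; apply/seteqP; split => // x _.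
  by apply: contrapT => ?; apply: H; exists x.
have [n [Sn Nn] AU] := IHN _ (bornologyU1 _ x BA).
exists n; last by move=> y Ay; apply: AU; left.
split=> //; rewrite ltn_neqAle Nn andbT; apply/eqP => nN.
by apply: UNx; rewrite nN; apply: AU; right.
Qed.

(* It suffices to control the selection on an index set [S] whose choices
   already accumulate at [zero]. *)
Lemma Omega_at_range (F : nat -> set (X -> R)) (S : set nat) (a : nat -> X -> R) :
  (forall n, exists h, [/\ F n h, USCb h, usc_above zero h & h <> zero]) ->
  (forall n, S n -> [/\ F n (a n), USCb (a n), usc_above zero (a n) & a n <> zero]) ->
  cl B (a @` S) zero ->
  exists b : nat -> X -> R, (forall n, F n (b n)) /\ Omega_at zero B (range b).
Proof.
move=> /choice[c cP] aP cla0.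
pose b n := if `[< S n >] then a n else c n.
have bP n : [/\ F n (b n), USCb (b n), usc_above zero (b n) & b n <> zero].
  by rewrite /b; case: asboolP => // /aP.
exists b; split; first by move=> n; have [] := bP n.
split.
- by move=> _ [n _ <-]; have [] := bP n.
- by move=> [n _ bn0]; have [] := bP n.
- apply: closure_subset cla0 => _ [n Sn <-]; exists n => //.
  by rewrite /b; case: asboolP.
- by move=> _ [n _ <-]; have [] := bP n.
Qed.

(** * Upper dense and upper sequentially dense sets: members above a function, translation *)

Lemma Phi_up_USCb Phi F : Phi_up Phi R B F -> F `<=` @USCb R X.
Proof. by case: Phi => -[]. Qed.

(** Density above [f], tested at [f] itself on the empty member of [B], already produces such an
    [h]; in the sequential case any term will do. *)
Lemma Phi_up_above Phi F f : Phi_up Phi R B F -> USCb f ->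
  exists2 h, F h & usc_above f h.
Proof.
case: Phi => -[FU Fup] Uf; last by have [h [Fh _ hf]] := Fup f Uf; exists (h 0%N).
have [_ cl_up] := Fup f Uf.
have /clP/(_ set0 1 (bornology0 bornB) ltr01) := cl_up f (conj Uf (fun=> lexx _)).
by move=> [h [Fh hf] _]; exists h.
Qed.

(** Subtracting [d] from approximations of [f \+ d] from above within [F] gives approximations of
    [f] from above. *)
Lemma Phi_up_translate Phi F d : USCb d -> Phi_up Phi R B F ->
  Phi_up Phi R B [set g | USCb g /\ F (g \+ d)].
Proof.
move=> Ud; have subK h : (h \- d) \+ d = h by apply/funext => x /=; rewrite subrK.
have above f h : USCb f -> usc_above (f \+ d) h -> usc_above f (h \- d) /\ USCb (h \- d).
  move=> Uf fdh; have fhd : usc_above f (h \- d).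
    split=> [x|]; first by rewrite /= lerBrDr; apply: fdh.1.
    have -> : (h \- d) \- f = h \- (f \+ d); last exact: fdh.2.
    by apply/funext => x /=; rewrite opprD addrA addrAC.
  (* As [- d] need not be upper semicontinuous, [h \- d] is written as a sum of two functions known
     to be so. *)
  split=> //; rewrite (_ : h \- d = f \+ ((h \- d) \- f)).
    by apply: USCbD => //; apply: fhd.2.
  by apply/funext => x /=; rewrite [RHS]addrC subrK.
case: Phi => -[FU Fup]; split=> [g []//|f Uf].
- split=> [h [[Uh _] [fh _]]//|g [Ug fg]].
  have [_ cl_up] := Fup _ (USCbD _ _ Uf Ud).
  have fgd x : (f \+ d) x <= (g \+ d) x by rewrite /= lerD2r.
  have /clP clg := cl_up (g \+ d) (conj (USCbD _ _ Ug Ud) fgd).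
  apply/clP => A e BA e0; have [h [Fh fdh] gh] := clg A e BA e0.
  have [fhd Uhd] := above _ _ Uf fdh.
  exists (h \- d); first by rewrite /= subK.
  by move=> x /gh /=; rewrite opprB addrA.
- have [h [Fh /cvg_famP hfd fdh]] := Fup _ (USCbD _ _ Uf Ud).
  exists (fun n => h n \- d); split=> [n||n].
  + by rewrite /= subK; split=> //; have [] := above _ _ Uf (fdh n).
  + apply/cvg_famP => A e BA e0; apply: filterS (hfd A e BA e0) => n nA x /nA /=.
    by rewrite opprB addrA.
  + by have [] := above _ _ Uf (fdh n).
Qed.

(** The members of [F] approximating [f] from above are translated by [- f]. That [f] is not in [F]
    keeps [zero] out of the translated set and, for sequences, makes its range infinite. *)
Lemma Phi_up_at Phi F f : Phi_up Phi R B F -> USCb f -> ~ F f ->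
  exists G, Phi_at Phi zero B G /\
    G `<=` [set g | F (g \+ f) /\ usc_above zero g].
Proof.
move=> Fup Uf Ff.
have above h : usc_above f h -> usc_above zero (h \- f).
  move=> [fh Uhf]; split=> [x|]; first by rewrite /= subr_ge0.
  by rewrite (_ : _ \- _ = h \- f)//; apply/funext => x /=; rewrite subr0.
have USC h : usc_above zero h -> USCb h.
  by move=> [_]; rewrite (_ : _ \- _ = h)//; apply/funext => x /=; rewrite subr0.
have subK h : (h \- f) \+ f = h by apply/funext => x /=; rewrite subrK.
case: Phi Fup => -[FU Fup].
  exists [set g | F (g \+ f) /\ usc_above zero g]; split=> //; split.
  - by move=> g [_ /USC].
  - move=> [+ _]; rewrite (_ : zero \+ f = f)//.
    by apply/funext => x /=; rewrite add0r.
  - have [_ cl_up] := Fup f Uf.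
    have /clP clf := cl_up f (conj Uf (fun=> lexx _)).
    apply/clP => A e BA e0; have [h [Fh fh] hA] := clf A e BA e0.
    exists (h \- f); first by rewrite /= subK; split=> //; exact: above.
    by move=> x /hA /=; rewrite sub0r opprB.
  - by move=> g [].
have [h [Fh /cvg_famP hf fh]] := Fup f Uf.
exists (range (fun n => h n \- f)); split; last first.
  by move=> _ [n _ <-] /=; rewrite subK; split=> //; exact: above.
split.
- by move=> _ [n _ <-]; apply/USC/above.
(* Each value is taken finitely often: [h m \- f] is nonzero at some [x], and convergence on
   [[set x]] excludes that value from some index on. *)
- apply: infinite_image; first exact: infinite_nat.
  move=> y; have [[m ym]|yN] := pselect (exists m, h m \- f = y); last first.
    by rewrite (_ : [set _ | _] = set0)// -subset0 => n /= [_ ?]; apply: yN; exists n.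
  have [x hx] : exists x, h m x != f x.
    apply: contrapT => H; apply: Ff; rewrite (_ : f = h m) ?Fh//; apply/funext => x.
    by apply: contrapT => /eqP ?; apply: H; exists x; rewrite eq_sym.
  have d0 : 0 < `|f x - h m x| by rewrite normr_gt0 subr_eq0 eq_sym.
  have [N _ NP] := hf _ _ (bornology_set1 x) d0.
  apply: (@sub_finite_set _ _ `I_N) => // n [_ yn]; rewrite /= ltnNge.
  apply/negP => Nn; have := NP n Nn x erefl.
  have : h n x - f x = h m x - f x by move: yn; rewrite -ym => /(congr1 (@^~ x)).
  by rewrite -![h _ x - _]opprB => /oppr_inj ->; rewrite ltxx.
- move=> e A e0 BA; have [N _ NP] := hf _ _ BA e0.
  apply: (@sub_finite_set _ _ ((fun n => h n \- f) @` `I_N)).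
    move=> _ [[n _ <-] [x Ax ex]]; exists n => //; rewrite /= ltnNge.
    apply/negP => Nn; have := NP n Nn x Ax.
    by move: ex; rewrite /= subr0 distrC leNgt => /negbTE ->.
  exact: finite_image.
- by move=> _ [n _ <-]; apply/above.
Qed.

(** * From families of functions accumulating at zero to covers *)

(** The hypothesis on [F] keeps the whole space out of the cover. In the [Gamma] case it also makes
    [f] to [[set x | f x < e]] finite-to-one: functions with the same image are all at least [e] at
    a common point, and only finitely many members of [F] are. *)
Lemma at_cover Phi F e : 0 < e -> Phi_at Phi zero B F ->
  ~ (exists f, [/\ F f, f <> zero & forall x, f x < e]) ->
  Phi_cover Phi B ((fun f => [set x | f x < e]) @` [set f | F f /\ f <> zero]).
Proof.
move=> e0 FPhi Fe.
have covered UU : (forall U, UU U -> open U) -> (forall A, B A -> exists2 U, UU U & A `<=` U) ->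
    open_cover UU.
  move=> oU BU; split=> //; apply/seteqP; split=> // x _.
  by have [U UUU xU] := BU _ (bornology_set1 x); exists U => //; exact: xU.
have opn : F `<=` @USCb R X -> forall U,
    ((fun f => [set x | f x < e]) @` [set f | F f /\ f <> zero]) U -> open U.
  by move=> FU _ [f [Ff _] <-]; have [+ _] := FU _ Ff; exact.
have notT : ~ ((fun f => [set x | f x < e]) @` [set f | F f /\ f <> zero]) [set: X].
  move=> [f [Ff f0] fT]; apply: Fe; exists f; split=> // x.
  by have : setT x by []; rewrite -fT.
case: Phi FPhi => [[FU F0 /clP clF Fab]|[FU Finf Ffin Fab]].
  have BU A : B A -> exists2 U, ((fun f => [set x | f x < e]) @` [set f | F f /\ f <> zero]) U
       & A `<=` U.
    move=> BA; have [f Ff fA] := clF A e BA e0.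
    exists [set x | f x < e].
      by exists f => //; split=> // f0; apply: F0; rewrite -f0.
    by move=> x /fA /=; rewrite sub0r normrN => /(le_lt_trans (ler_norm _)).
  split=> //; apply: covered => //; exact: opn.
have ge_e f x : e <= f x -> e <= `|f x - zero x|.
  by rewrite subr0 => /le_trans; apply; exact: ler_norm.
have Uinf : infinite_set ((fun f => [set x | f x < e]) @` [set f | F f /\ f <> zero]).
  apply: infinite_image.
    rewrite (_ : [set f | _] = F `\` [set zero]); last by [].
    by apply: infinite_setD.
  move=> U; have [[f [[Ff f0] fU]]|UN] :=
    pselect (exists f, (F f /\ f <> zero) /\ [set x | f x < e] = U); last first.
    by rewrite (_ : [set _ | _] = set0)// -subset0 => f /= ?; apply: UN; exists f.
  have [x xe] : exists x, e <= f x.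
    apply: contrapT => H; apply: Fe; exists f; split=> // x.
    by rewrite ltNge; apply/negP => ?; apply: H; exists x.
  apply: sub_finite_set (Ffin e [set x] e0 (bornology_set1 x)).
  move=> g [[Fg _] gU]; split=> //; exists x => //; apply: ge_e.
  rewrite leNgt; apply/negP => gx.
  have : [set y | g y < e] x by [].
  by rewrite gU -fU /= ltNge xe.
have Ucof A : B A -> finite_set [set U |
    ((fun f => [set x | f x < e]) @` [set f | F f /\ f <> zero]) U /\ ~ A `<=` U].
  move=> BA; apply: (@sub_finite_set _ _ ((fun f => [set x | f x < e]) @`
     [set f | F f /\ exists2 x, A x & e <= `|f x - zero x|])).
    move=> _ [[f [Ff _] <-] /existsNP[x /not_implyP[Ax /negP xe]]].
    exists f => //; split=> //; exists x => //; apply: ge_e.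
    by rewrite leNgt.
  by apply: finite_image; exact: Ffin.
split=> //; apply: covered; first exact: opn.
(* Were [A] inside no member, the whole infinite family would lie in the finite exceptional set. *)
move=> A /Ucof finA; apply: contrapT => H; apply: Uinf.
apply: sub_finite_set finA => U UU; split=> // AU; apply: H; by exists U.
Qed.


(** * Consequences of the density of the continuous functions; from functions back to covers *)

Section density.
Hypothesis Cb_dense : countably_dense B (@Cb R X).

Lemma USCb_Cb f : Cb f -> USCb f.
Proof. by case: Cb_dense => + _; apply. Qed.

Lemma Cb_approx f A e : USCb f -> B A -> 0 < e ->
  exists2 c, Cb c & forall x, A x -> `|f x - c x| < e.
Proof.
move=> Uf BA e0; have [G [_ GC clGf]] := Cb_dense.2 f Uf.
by have [c /GC Cc cA] := (clP _ _).1 clGf A e BA e0; exists c.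
Qed.

(* [g - f] need not be upper semicontinuous, but it is uniformly close on [A]
   to a difference of continuous functions. *)
Lemma usc_above_approx f g A e : USCb f -> USCb g -> (forall x, f x <= g x) ->
  B A -> 0 < e ->
  exists u, [/\ USCb u, forall x, 0 <= u x &
    forall x, A x -> `|g x - (f x + u x)| < e].
Proof.
move=> Uf Ug fg BA e0; have e20 : 0 < e / 2 by rewrite divr_gt0.
have [c Cc fc] := Cb_approx f A _ Uf BA e20.
have [d Cd gd] := Cb_approx g A _ Ug BA e20.
(* The positive part suffices: where [d < c] on [A], the bounds [0 <= g - f < d - c + e] put [g - f]
   below [e]. *)
exists (fun x => Num.max ((d \- c) x) 0); split.
- by apply: USCb_max; apply/USCb_Cb/CbB.
- by move=> x; rewrite le_max lexx orbT.
- move=> x Ax; move: (fc x Ax) (gd x Ax) (fg x); rewrite !ltr_norml /=.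
  by case: (leP (d x - c x) 0) => ? /andP[? ?] /andP[? ?] ?; apply/andP; split; lra.
Qed.

(** [lift] leaves [f] unchanged on [U] and adds [1 + |M|] off [U], which brings it to at least 1
    there when [|f| <= M]. For [Omega], an approximation [f \+ u] of [g] is lifted off some [U]
    containing [A]; for [Gamma], [f] is lifted off the terms of an injective enumeration of the
    cover, which eventually contain [A]. *)
Lemma Phi_up_cover (Phi : cover_kind) (UU : set (set X)) : Phi_cover Phi B UU ->
  Phi_up Phi R B
    [set h | USCb h /\ exists2 U, UU U & forall x, ~ U x -> 1 <= h x].
Proof.
pose lift (f : X -> R) (M : R) (U : set X) : X -> R :=
  f \+ patch (fun=> 1 + `|M|) U (fun=> 0).
have lift_above f M U : open U -> usc_above f (lift f M U).
  move=> oU; apply: usc_above_addr; first exact: USCb_patch0.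
  by move=> x; rewrite /patch; case: ifP => // _; rewrite addr_ge0.
have USCb_lift f M U : USCb f -> open U -> USCb (lift f M U).
  by move=> Uf oU; apply: USCbD => //; exact: USCb_patch0.
have lift_ge1 f M U x : (forall x, `|f x| <= M) -> ~ U x -> 1 <= lift f M U x.
  move=> fM Ux; rewrite /lift /patch /= memNset//.
  by have := fM x; rewrite ler_norml => /andP[]; have := ler_norm M; lra.
have lift_eq f M U x : U x -> lift f M U x = f x.
  by move=> Ux; rewrite /lift /patch /= mem_set// addr0.
case: Phi => [[[oUU _] _ UUB]|[[oUU _] _ UUinf UUB]]; split=> [h []//|f Uf].
  split=> [h [[Uh _] [fh _]]//|g [Ug fg]].
  apply/clP => A e BA e0.
  have [u [Uu u0 gu]] := usc_above_approx f g A e Uf Ug fg BA e0.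
  have Ufu := USCbD _ _ Uf Uu; have [_ /bounded_funP[M fuM]] := Ufu.
  have [U UUU AU] := UUB A BA; have oU := oUU U UUU.
  exists (lift (f \+ u) M U); first split.
  - by split; [exact: USCb_lift|exists U => // x; exact: lift_ge1].
  - exact: usc_above_trans (usc_above_addr _ _ Uu u0) (lift_above _ _ _ oU).
  - by move=> x Ax; rewrite lift_eq; [exact: gu|exact: AU].
have [_ /bounded_funP[M fM]] := Uf.
have [U [UU_U Ucof]] := infinite_set_seq _ _ UUinf.
exists (fun n => lift f M (U n)); split.
- move=> n; split; first exact: USCb_lift (oUU _ _).
  by exists (U n) => // x; exact: lift_ge1.
- apply/cvg_famP => A e BA e0.
  apply: filterS (Ucof _ (UUB A BA)) => n AUn x Ax.
  rewrite lift_eq ?subrr ?normr0//.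
  by apply: contrapT => Unx; apply: AUn; split=> // /(_ x Ax).
- by move=> n; apply/lift_above/oUU.
Qed.

Lemma Phi_up_USCbT Phi : Phi_up Phi R B (@USCb R X).
Proof.
case: Phi; split=> // f Uf.
  split=> [h [Uh [fh _]]//|g [Ug fg]]; apply/clP => A e BA e0.
  have [u [Uu u0 gu]] := usc_above_approx f g A e Uf Ug fg BA e0.
  by exists (f \+ u) => //; split; [exact: USCbD|exact: usc_above_addr].
exists (fun=> f); split=> // [|_].
  by apply/cvg_famP => A e BA e0; apply: nearW => n x _; rewrite subrr normr0.
split=> //; rewrite (_ : f \- f = fun=> 0); first exact: USCb_cst.
by apply/funext => x /=; rewrite subrr.
Qed.

Lemma separable_of_S1_Dense Phi :
  S1 (Phi_up Phi R B) (Dense R B) -> separable_USCb R B.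
Proof.
move=> /(_ (fun=> @USCb R X) (fun=> Phi_up_USCbT Phi)) [a [_ Da]].
by exists (range a); split=> //; apply: card_image_le.
Qed.

(** If [|a n| < 1] on [A], then [A] misses the complement of [U n], where [a n] is at least 1; hence
    [A] is inside [U n]. *)
Lemma S1_cover_of_S1_up Phi (C : set (set (X -> R))) :
  (forall F, C F -> cl B F zero) ->
  S1 (Phi_up Phi R B) C -> S1 (Phi_cover Phi B) (Omega_cover B).
Proof.
move=> Ccl selC UU UUPhi.
have [a [aUU /Ccl cla]] := selC _ (fun n => Phi_up_cover Phi (UU n) (UUPhi n)).
have /choice[U UP] : forall n, exists U, UU n U /\ forall x, ~ U x -> 1 <= a n x.
  by move=> n; have [_ [U UUU Ua]] := aUU n; exists U.
exists U; split; first by move=> n; exact: (UP n).1.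
have oUT V : range U V -> open V /\ V <> [set: X].
  move=> [n _ <-]; have := UUPhi n; have := (UP n).1.
  case: (Phi) => UUUn [[oUU _] UUT] => [_|_ _]; split; try exact: oUU;
    by move=> UT; apply: UUT; rewrite -UT.
have UB A : B A -> exists2 V, range U V & A `<=` V.
  move=> BA; have [_ [n _ <-] nA] := (clP _ _).1 cla A 1 BA ltr01.
  exists (U n) => [|x Ax]; first by exists n.
  apply: contrapT => /(UP n).2 anx; have := nA x Ax.
  by rewrite sub0r normrN ltNge (le_trans anx)// ler_norm.
split=> //; last by move=> /oUT[].
split; first by move=> V /oUT[].
apply/seteqP; split=> // x _.
by have [V UV xV] := UB _ (bornology_set1 x); exists V => //; exact: xV.
Qed.

End density.

(** * Transfer of the selection principles, with thresholds tending to 0 *)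

Let c_ n : R := n.+1%:R^-1.

Let c_gt0 n : 0 < c_ n. Proof. by rewrite invr_gt0 ltr0n. Qed.

Let c_small e : 0 < e -> exists N, forall n, (N <= n)%N -> c_ n < e.
Proof.
move=> e0; have [N _ NP] := near_infty_natSinv_lt (PosNum e0).
by exists N => n; exact: NP.
Qed.

Lemma USCb_usc_above0 f : usc_above zero f -> USCb f.
Proof.
by move=> [_]; rewrite (_ : _ \- _ = f)//; apply/funext => x /=; rewrite subr0.
Qed.

Lemma S1_at_of_S1_cover Phi : S1 (Phi_cover Phi B) (Omega_cover B) ->
  S1 (Phi_at Phi zero B) (Omega_at zero B).
Proof.
move=> sel F FPhi.
have Fne n : exists f, F n f /\ f <> zero.
  case: (Phi) (FPhi n) => [[_ F0 /clP clF _]|[_ Finf _ _]].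
    have [f Ff _] := clF set0 1 (bornology0 bornB) ltr01.
    by exists f; split=> // f0; apply: F0; rewrite -f0.
  apply: contrapT => H; apply: Finf; apply: sub_finite_set (finite_set1 zero).
  by move=> f Ff; apply: contrapT => f0; apply: H; exists f.
have Fabove n f : F n f -> usc_above zero f.
  by case: (Phi) (FPhi n) => [[_ _ _]|[_ _ _]]; apply.
have good n f : F n f -> f <> zero -> [/\ F n f, USCb f, usc_above zero f & f <> zero].
  by move=> Ff f0; have fa := Fabove n f Ff; split=> //; exact: USCb_usc_above0.
have Fgood n : exists h, [/\ F n h, USCb h, usc_above zero h & h <> zero].
  by have [f [Ff f0]] := Fne n; exists f; exact: good.
pose P n f := [/\ F n f, f <> zero & forall x, f x < c_ n].
have norm_lt n f x : F n f -> f x < c_ n -> `|zero x - f x| < c_ n.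
  by move=> /Fabove[f0 _] ?; rewrite sub0r normrN ger0_norm// f0.
have [io|[N evN]] := infinitely_often_or_eventually_not (fun n => exists f, P n f).
  have /choice[a aP] : forall n, exists f, (exists f, P n f) -> P n f.
    by move=> n; have [[f Pf]|] := pselect (exists f, P n f); [exists f|exists zero].
  apply: (Omega_at_range F [set n | exists f, P n f] a Fgood).
    by move=> n /aP [? ? _]; exact: good.
  apply/clP => A e BA e0; have [N eN] := c_small e e0; have [n Nn Pn] := io N.
  exists (a n); first by exists n.
  have [Fa _ ac] := aP n Pn.
  by move=> x _; rewrite (lt_trans (norm_lt n _ _ Fa (ac x)))// eN.
(* From [N] on no nonzero member of [F n] stays below [c_ n] everywhere, as [at_cover] requires. *)
have [U [FU UC]] := S1_tail _ _ _
  (fun n => (fun f => [set x | f x < c_ n]) @` [set f | F n f /\ f <> zero]) N sel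
  (fun n Nn => at_cover Phi (F n) (c_ n) (c_gt0 n) (FPhi n) (evN n Nn)).
have /choice[a aP] : forall n, exists f, (N <= n)%N ->
    [/\ F n f, f <> zero & [set x | f x < c_ n] = U n].
  move=> n; have [/FU[f [Ff f0] fU]|_] := boolP (N <= n)%N; last by exists zero.
  by exists f.
apply: (Omega_at_range F [set n | (N <= n)%N] a Fgood).
  by move=> n /aP [? ? _]; exact: good.
apply/clP => A e BA e0; have [M eM] := c_small e e0.
(* Asking for [M <= n] makes the threshold of the chosen set smaller than [e]. *)
have [n [Nn Mn] AU] := Omega_cover_tail U _ M A UC BA.
exists (a n); first by exists n.
have [Fa _ aU] := aP n Nn.
move=> x /AU; rewrite -aU /= => ax.
by rewrite (lt_trans (norm_lt n _ _ Fa ax))// eM.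
Qed.

(* Selecting around the constants 1/(n+1) rather than around 0 keeps the
   selected functions nonzero even when 0 belongs to the given sets. *)
Lemma S1_up_of_S1_at Phi : S1 (Phi_at Phi zero B) (Omega_at zero B) ->
  S1 (Phi_up Phi R B) (Omega_at zero B).
Proof.
move=> sel F Fup; pose k n : X -> R := fun=> c_ n.
have good n h : F n h -> usc_above (k n) h ->
    [/\ F n h, USCb h, usc_above zero h & h <> zero].
  move=> Fh kh; have Uh := Phi_up_USCb _ _ (Fup n) h Fh.
  split=> //; last first.
    have [x _] := bornology_nonempty; move=> /(congr1 (@^~ x)) hx0.
    by have := kh.1 x; rewrite hx0 leNgt c_gt0.
  split=> [x|]; first exact: le_trans (ltW (c_gt0 n)) (kh.1 x).
  by rewrite (_ : _ \- _ = h)//; apply/funext => x /=; rewrite subr0.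
have Fgood n : exists h, [/\ F n h, USCb h, usc_above zero h & h <> zero].
  by have [h Fh kh] := Phi_up_above _ _ _ (Fup n) (USCb_cst (c_ n)); exists h; exact: good.
have kk n : usc_above (k n) (k n).
  split=> //; rewrite (_ : _ \- _ = fun=> 0); first exact: USCb_cst.
  by apply/funext => x /=; rewrite subrr.
(* If [k n] lies in [F n] infinitely often, it is selected at those stages; otherwise [Phi_up_at]
   applies around [k n] from [N] on. *)
have [io|[N evN]] := infinitely_often_or_eventually_not (fun n => F n (k n)).
  apply: (Omega_at_range F [set n | F n (k n)] k Fgood).
    by move=> n Fk; exact: good.
  apply/clP => A e BA e0; have [N eN] := c_small e e0; have [n Nn Fk] := io N.
  exists (k n); first by exists n.
  by move=> x _; rewrite /k sub0r normrN ger0_norm ?eN// ltW.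
have /choice[G GP] : forall n, exists G, (N <= n)%N -> Phi_at Phi zero B G /\
    G `<=` [set g | F n (g \+ k n) /\ usc_above zero g].
  move=> n; have [Nn|_] := boolP (N <= n)%N; last by exists set0.
  by have [G GP] := Phi_up_at _ _ _ (Fup n) (USCb_cst (c_ n)) (evN n Nn); exists G.
have [g [Gg [_ g0 clg _]]] := S1_tail _ _ _ G N sel (fun n Nn => (GP n Nn).1).
have gP n : (N <= n)%N -> F n (g n \+ k n) /\ usc_above zero (g n).
  by move=> Nn; exact: (GP n Nn).2 (Gg n Nn).
apply: (Omega_at_range F [set n | (N <= n)%N] (fun n => g n \+ k n) Fgood).
  move=> n /gP[Fgk gn0]; apply: good => //.
  have := usc_above_addl _ _ (k n) gn0; rewrite (_ : zero \+ k n = k n)//.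
  by apply/funext => x /=; rewrite add0r.
apply/clP => A e BA e0; have e20 : 0 < e / 2 by rewrite divr_gt0.
have [M eM] := c_small _ e20.
have gz n : [set n | (N <= n)%N] n -> g n <> zero.
  by move=> Nn gn; apply: g0; exists n.
(* A late index makes both summands of [g n \+ k n] smaller than [e / 2] on [A]. *)
have [_ [n [Nn Mn] <-] gA] := (clP _ _).1 (cl_tail g zero _ M gz clg) A _ BA e20.
exists (g n \+ k n); first by exists n.
move=> x /gA; have := eM n Mn; have := c_gt0 n.
by rewrite /= !ltr_norml /k /zero => ? ? /andP[? ?]; apply/andP; split; lra.
Qed.

Lemma S1_Dense_of_S1_at Phi : separable_USCb R B ->
  S1 (Phi_up Phi R B) (Omega_at zero B) -> S1 (Phi_up Phi R B) (Dense R B).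
Proof.
move=> [D [/pcard_geP[d'] [DU clD]]] sel F Fup.
(* The surjection [d'] may take values outside [D]; those not in [USCb] are replaced by [zero]. *)
pose d n := if `[< USCb (d' n) >] then d' n else zero.
have Ud n : USCb (d n) by rewrite /d; case: asboolP => // _; exact: USCb_cst.
(* The codes [pickle (i, j)] with [i] fixed form the piece of the index set devoted to [d i]. *)
have /choice[a aP] i : exists a : nat -> X -> R,
    (forall j, F (pickle (i, j)) (a j)) /\ cl B (range a) (d i).
  have [g [Fg [_ _ clg _]]] := sel _ (fun j => Phi_up_translate _ _ _ (Ud i) (Fup (pickle (i, j)))).
  exists (fun j => g j \+ d i); split; first by move=> j; have [] := Fg j.
  apply/clP => A e BA e0; have [_ [j _ <-] gA] := (clP _ _).1 clg A e BA e0.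
  exists (g j \+ d i); first by exists j.
  by move=> x /gA /=; rewrite opprD addrCA subrr addr0 sub0r.
(* [b0] provides a choice at indices that code no pair. *)
have /choice[b0 b0P] n : exists h, F n h.
  by have [h Fh _] := Phi_up_above _ _ _ (Fup n) (USCb_cst 0); exists h.
pose b n := if pickle_inv n is Some (i, j) then a i j else b0 n.
have b_pickle i j : b (pickle (i, j)) = a i j by rewrite /b pickleK_inv.
have Fb n : F n (b n).
  rewrite /b; case E : pickle_inv => [[i j]|]; last exact: b0P.
  by have := (aP i).1 j; have := @pickle_invK (nat * nat)%type n; rewrite E /= => ->.
exists b; split=> //; split=> [_ [n _ <-]|f /clD/clP clf].
  exact: Phi_up_USCb (Fup n) _ (Fb n).
apply/clP => A e BA e0; have e20 : 0 < e / 2 by rewrite divr_gt0.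
have [h Dh hA] := clf A _ BA e20.
have [i _ dih] := @surj _ _ _ _ d' _ Dh.
have di : d i = h by rewrite /d dih; case: asboolP => // -[]; exact: DU.
have [_ [j _ <-] aA] := (clP _ _).1 (aP i).2 A _ BA e20.
exists (a i j); first by exists (pickle (i, j)) => //; exact: b_pickle.
move=> x Ax; move: (hA x Ax) (aA x Ax); rewrite di !ltr_norml.
by move=> /andP[? ?] /andP[? ?]; apply/andP; split; lra.
Qed.

End bornological.

(** * The cycle of implications *)

Theorem theorem3 (R : realType) (X : topologicalType) (B : set (set X))
    (Phi : cover_kind) (X_inf : infinite_set [set: X])
    (X_T2 : hausdorff_space X) (bornB : bornology B)
    (Cb_dense : countably_dense B (@Cb R X)) :
  let zero : X -> R := fun=> 0 in
  [<-> (* a *) S1 (Phi_up Phi R B) (Dense R B);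
       (* b *) separable_USCb R B /\ S1 (Phi_cover Phi B) (Omega_cover B);
       (* c *) separable_USCb R B /\ S1 (Phi_at Phi zero B) (Omega_at zero B);
       (* d *) separable_USCb R B /\ S1 (Phi_up Phi R B) (Omega_at zero B)].
Proof.
move=> zero; tfae.
- move=> selD; split; first exact: separable_of_S1_Dense Cb_dense _ selD.
  apply: (S1_cover_of_S1_up bornB Cb_dense Phi (Dense R B)) => // F [_].
  by apply; exact: USCb_cst.
- by move=> [sep]; split=> //; exact: S1_at_of_S1_cover.
- by move=> [sep]; split=> //; exact: S1_up_of_S1_at.
- by move=> [sep]; exact: S1_Dense_of_S1_at.
Qed.
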